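(* Let $m,d\in\mathbb{N}$, $N=2^m$, let $\boldsymbol{\gamma}=(\gamma_j)_{j\ge1}$ be a given sequence of positive (product) weights, and let integer reduction indices $w_j$ with $0=w_1\le w_2\le\cdots$ be given. Denote by $d^*$ the largest integer such that $w_{d^*}<m$ (with $d^*=\infty$ if $w_j<m$ for all $j$). Then the fast reduced CBC-DBD algorithm constructs a generating vector $\boldsymbol{z}=(Y_1z_1,\ldots,Y_dz_d)$, where $Y_j=2^{w_j}$, using $$\mathcal{O}\left(\min\{d,d^*\}\,2^m+\sum_{s=1}^{\min\{d,d^*\}}(m-w_s)\,2^m\right)$$ operations and requiring $\mathcal{O}(2^m)$ memory.
   Context: Cost model: each real arithmetic operation, comparison, and evaluation of $\log$ or $\sin$ counts as one operation, and storing a real number costs one unit of memory; storage of the input and output, and the trivial assignment of the constants $z_j=1$ for $j>d^*$ and the final scaling by $Y_j$, are not counted. The implied constants are absolute. Fast reduced CBC-DBD algorithm. Input: $m,d\in\mathbb{N}$, positive weights $(\gamma_j)_{j\ge1}$ (product weights, $\gamma_{\mathfrak{u}}=\prod_{j\in\mathfrak{u}}\gamma_j$), integers $0=w_1\le w_2\le\cdots$. A vector $\boldsymbol{u}=(u(1),\ldots,u(2^m-1))$ of real numbers is kept in memory. (i) Initialization: for $t=2,\ldots,m$ and odd $k\in\{1,\ldots,2^t-1\}$ set $u(k2^{m-t})=1+\gamma_1\log\left(\frac{1}{\sin^2(\pi k/2^t)}\right)$. Set $z_1=1$. (ii) For $s=2,\ldots,\min\{d,d^*\}$ successively: set $z_{s,1}=1$.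 For $v=2,\ldots,m-w_s$ successively: let $z^*\in\{0,1\}$ be a minimizer over $z\in\{0,1\}$ of $h_{s,v,m,\boldsymbol{\gamma},\boldsymbol{w}}(z_{s,v-1}+z2^{v-1})$, where $h$ is evaluated from the stored values via $$h_{s,v,m,\boldsymbol{\gamma},\boldsymbol{w}}(x)=\sum_{t=v}^{m-w_s}\frac{1}{2^{t-v}}\sum_{\ell=0}^{2^{w_s}-1}\ \sum_{\substack{k=\ell2^t+1\\k\ \mathrm{odd}}}^{(\ell+1)2^t-1}u(k2^{m-w_s-t})\left(1+\gamma_s\log\left(\frac{1}{\sin^2(\pi kx/2^v)}\right)\right);$$ set $z_{s,v}=z_{s,v-1}+z^*2^{v-1}$; then for $\ell=0,\ldots,2^{w_s}-1$ and odd $k\in\{\ell2^v+1,\ldots,(\ell+1)2^v-1\}$ replace $u(k2^{m-w_s-v})$ by $u(k2^{m-w_s-v})\left(1+\gamma_s\log\left(\frac{1}{\sin^2(\pi kz_{s,v}/2^v)}\right)\right)$. After the loop over $v$ set $z_s=z_{s,m-w_s}$. (iii) If $d>d^*$ set $z_{d^*+1}=\cdots=z_d=1$. Output $\boldsymbol{z}=(Y_1z_1,\ldots,Y_dz_d)$ with $Y_j=2^{w_j}$. *)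

(* Defs.v *)
From HB Require Import structures.
From mathcomp Require Import all_boot all_order all_algebra.
From mathcomp Require Import reals exp trigo.

Set Implicit Arguments.
Unset Strict Implicit.
Unset Printing Implicit Defensive.

Import Order.TTheory GRing.Theory Num.Theory.
Local Open Scope ring_scope.

(* [D] is d*, the largest j >= 1 with w_j < m; [None] encodes d* = oo. *)
Definition is_dstar (m : nat) (w : nat -> nat) (D : option nat) : Prop :=
  if D is Some n then
    [/\ (1 <= n)%N, (w n < m)%N
      & forall j, (1 <= j)%N -> (w j < m)%N -> (j <= n)%N]
  else forall j, (1 <= j)%N -> (w j < m)%N.

Definition min_dstar (d : nat) (D : option nat) : nat :=
  if D is Some n then minn d n else d.

(* All indices (of weights, of components and of u) start at 1, the values at
   0 being irrelevant.  Components z_j are natural numbers. *)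
Section Procedure.
Context {R : realType}.
Variables (m : nat) (w : nat -> nat) (gamma : nat -> R).
Implicit Types (u : nat -> R) (s v t l k x i : nat).

Definition factor (g y : R) : R := 1 + g * ln (1 / sin y ^+ 2).

Definition dbd_h u s v x : R :=
  \sum_(v <= t < (m - w s).+1)
    1 / 2 ^+ (t - v) *
    \sum_(0 <= l < 2 ^ w s)
      \sum_((l * 2 ^ t).+1 <= k < l.+1 * 2 ^ t | odd k)
        u (k * 2 ^ (m - w s - t))%N
        * factor (gamma s) (pi * (k%:R * x%:R) / 2 ^+ v).

(* No condition is put on the entries of u that are not initialized. *)
Definition dbd_init u : Prop :=
  forall t k, (2 <= t <= m)%N -> (1 <= k <= 2 ^ t - 1)%N -> odd k ->
    u (k * 2 ^ (m - t))%N = factor (gamma 1%N) (pi * k%:R / 2 ^+ t).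

Definition dbd_update s v x u u' : Prop :=
  (forall l k, (l < 2 ^ w s)%N -> (l * 2 ^ v < k < l.+1 * 2 ^ v)%N -> odd k ->
     u' (k * 2 ^ (m - w s - v))%N
     = u (k * 2 ^ (m - w s - v))%N
       * factor (gamma s) (pi * (k%:R * x%:R) / 2 ^+ v)) /\
  (forall i,
     (forall l k, (l < 2 ^ w s)%N -> (l * 2 ^ v < k < l.+1 * 2 ^ v)%N ->
        odd k -> i <> (k * 2 ^ (m - w s - v))%N) ->
     u' i = u i).

(* The trace of an execution: zz s v is z_{s,v}, and U s v is the vector u at
   the end of the pass v of the loop on the digits of z_s.  Thus U s 1 is the
   vector at the beginning of the treatment of s, i.e. the one left by s - 1,
   and U 1 (m - w 1) is the vector left by the initialization.
   Here n = min(d, d* ), and a minimizer z* in {0, 1} is a boolean. *)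
Definition dbd_trace (d n : nat) (zz : nat -> nat -> nat)
    (U : nat -> nat -> nat -> R) (z : nat -> nat) : Prop :=
  [/\ dbd_init (U 1%N (m - w 1)%N) /\ z 1%N = 1%N,
      forall s, (2 <= s <= n)%N ->
        [/\ zz s 1%N = 1%N, U s 1%N = U s.-1 (m - w s.-1)%N
          & z s = zz s (m - w s)%N],
      forall s v, (2 <= s <= n)%N -> (2 <= v <= m - w s)%N ->
        (exists2 zstar : bool,
            forall b : bool,
              dbd_h (U s v.-1) s v (zz s v.-1 + zstar * 2 ^ v.-1)
              <= dbd_h (U s v.-1) s v (zz s v.-1 + b * 2 ^ v.-1)
          & zz s v = (zz s v.-1 + zstar * 2 ^ v.-1)%N) /\
        dbd_update s v (zz s v) (U s v.-1) (U s v)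
    & forall j, (n < j <= d)%N -> z j = 1%N].

(* z = (z_1, ..., z_d) is a possible result, before scaling by Y_j = 2^{w_j}. *)
Definition dbd_result (d n : nat) (z : nat -> nat) : Prop :=
  exists zz U, dbd_trace d n zz U z.

End Procedure.

(* Locations: the entries of the vector u, scratch registers, and the output
   (which is not counted as memory). *)
Inductive loc := U of nat | Reg of nat | Out of nat.

Definition loc_code (a : loc) : nat + nat + nat :=
  match a with U i => inl (inl i) | Reg i => inl (inr i) | Out i => inr i end.
Definition loc_decode (c : nat + nat + nat) : loc :=
  match c with inl (inl i) => U i | inl (inr i) => Reg i | inr i => Out i end.
Lemma loc_codeK : cancel loc_code loc_decode. Proof. by case. Qed.
HB.instance Definition _ := Equality.copy loc (can_type loc_codeK).

Definition working (a : loc) : bool := if a is Out _ then false else true.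

(* The only literals are 0, 1, 2 and pi, so that all other reals, including
   2^t and the real value of a loop index, must be computed by counted
   operations. *)
Inductive literal := L0 | L1 | L2 | LPi.
Inductive unop := OLog | OSin.
Inductive binop := OAdd | OMul | ODiv.

(* [Weight j] reads gamma_j in the input (not counted as memory). *)
Inductive expr :=
  | Lit of literal
  | Weight of nat
  | Get of loc
  | Un of unop & expr
  | Bin of binop & expr & expr.

Declare Scope expr_scope.
Delimit Scope expr_scope with expr.
Bind Scope expr_scope with expr.
Arguments Un _ _%_expr.
Arguments Bin _ _%_expr _%_expr.

(* [Cond le e1 e2 c1 c2] runs c1 if e1 <= e2 (when le = true), resp. if
   e1 < e2 (when le = false), and c2 otherwise. *)
Inductive cmd :=
  | Skip
  | Assign of loc & expr
  | Seq of cmd & cmd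
  | Cond of bool & expr & expr & cmd & cmd.

(* Loops on integer ranges are unrolled: as integer computations, their control
   and the computation of the addresses are free. *)
Definition For (r : seq nat) (body : nat -> cmd) : cmd :=
  foldr (fun k c => Seq (body k) c) Skip r.

Section Semantics.
Context {R : realType}.
Variable gamma : nat -> R.
Implicit Types (mu : loc -> R) (e : expr) (c : cmd).

Definition eval_lit (a : literal) : R :=
  match a with L0 => 0 | L1 => 1 | L2 => 2 | LPi => pi end.
Definition eval_un (o : unop) (x : R) : R :=
  match o with OLog => ln x | OSin => sin x end.
Definition eval_bin (o : binop) (x y : R) : R :=
  match o with OAdd => x + y | OMul => x * y | ODiv => x / y end.

Fixpoint eval mu e : R :=
  match e with
  | Lit a => eval_lit a
  | Weight j => gamma j
  | Get a => mu a
  | Un o e1 => eval_un o (eval mu e1)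
  | Bin o e1 e2 => eval_bin o (eval mu e1) (eval mu e2)
  end.

Definition test mu (le : bool) e1 e2 : bool :=
  eval mu e1 < eval mu e2 ?<= if le.

Fixpoint exec c mu : loc -> R :=
  match c with
  | Skip => mu
  | Assign a e => fun b => if b == a then eval mu e else mu b
  | Seq c1 c2 => exec c2 (exec c1 mu)
  | Cond le e1 e2 c1 c2 => if test mu le e1 e2 then exec c1 mu else exec c2 mu
  end.

Fixpoint expr_ops e : nat :=
  match e with
  | Un _ e1 => (expr_ops e1).+1
  | Bin _ e1 e2 => (expr_ops e1 + expr_ops e2)%N.+1
  | _ => 0
  end.

(* The number of operations of the execution of c from the memory mu. *)
Fixpoint ops c mu : nat :=
  match c with
  | Skip => 0
  | Assign _ e => expr_ops e
  | Seq c1 c2 => (ops c1 mu + ops c2 (exec c1 mu))%N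
  | Cond le e1 e2 c1 c2 =>
      ((expr_ops e1 + expr_ops e2).+1
       + (if test mu le e1 e2 then ops c1 mu else ops c2 mu))%N
  end.

(* The number of cells holding intermediate values in the evaluation of e from
   left to right. *)
Fixpoint expr_temps e : nat :=
  match e with
  | Un _ e1 => expr_temps e1
  | Bin _ e1 e2 => maxn (expr_temps e1) (expr_temps e2).+1
  | _ => 1
  end.

Fixpoint temps c mu : nat :=
  match c with
  | Skip => 0
  | Assign _ e => expr_temps e
  | Seq c1 c2 => maxn (temps c1 mu) (temps c2 (exec c1 mu))
  | Cond le e1 e2 c1 c2 =>
      maxn (maxn (expr_temps e1) (expr_temps e2).+1)
           (if test mu le e1 e2 then temps c1 mu else temps c2 mu)
  end.

Fixpoint expr_locs e : seq loc :=
  match e with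
  | Get a => [:: a]
  | Un _ e1 => expr_locs e1
  | Bin _ e1 e2 => expr_locs e1 ++ expr_locs e2
  | _ => [::]
  end.

(* The locations read or written in the execution of c from mu. *)
Fixpoint locs c mu : seq loc :=
  match c with
  | Skip => [::]
  | Assign a e => a :: expr_locs e
  | Seq c1 c2 => locs c1 mu ++ locs c2 (exec c1 mu)
  | Cond le e1 e2 c1 c2 =>
      expr_locs e1 ++ expr_locs e2
      ++ (if test mu le e1 e2 then locs c1 mu else locs c2 mu)
  end.

Definition memory c mu : nat :=
  (size (undup [seq a <- locs c mu | working a]) + temps c mu)%N.

End Semantics.

Declare Scope cmd_scope.
Delimit Scope cmd_scope with cmd.
Notation "a ::= e" := (Assign a e%expr) (at level 70) : cmd_scope.
Notation "c1 ;; c2" := (Seq c1 c2)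
  (at level 80, right associativity) : cmd_scope.

Coercion Get : loc >-> expr.
Notation "0" := (Lit L0) : expr_scope.
Notation "1" := (Lit L1) : expr_scope.
Notation "2" := (Lit L2) : expr_scope.
Notation "e1 + e2" := (Bin OAdd e1 e2) : expr_scope.
Notation "e1 * e2" := (Bin OMul e1 e2) : expr_scope.
Notation "e1 / e2" := (Bin ODiv e1 e2) : expr_scope.

Definition rK : loc := Reg 0.  (* the value of the index k *)
Definition rP : loc := Reg 1.  (* 2^t in the initialization, else 2^v *)
Definition rQ : loc := Reg 2.  (* 1 / 2^(t - v) *)
Definition rF : loc := Reg 3.  (* 1 + gamma_s log(1 / sin^2(..)) *)
Definition rS : loc := Reg 4.  (* the two inner sums of h *)
Definition rZ : loc := Reg 5.  (* z_{s,v} *)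
Definition rX : loc := Reg 6.  (* z_{s,v-1} + 2^(v-1) *)
Definition rH0 : loc := Reg 7. (* h at z_{s,v-1} *)
Definition rH1 : loc := Reg 8. (* h at z_{s,v-1} + 2^(v-1) *)

Definition odds (a b : nat) : seq nat := [seq k <- index_iota a b | odd k].

Definition fast_factor (s : nat) (arg : expr) : cmd :=
  (rF ::= Un OSin arg ;;
   rF ::= 1 + Weight s * Un OLog (1 / (rF * rF)))%cmd.

Definition fast_init (m : nat) : cmd :=
  (rP ::= 2 ;;
   For (index_iota 2 m.+1) (fun t =>
     rP ::= rP * 2 ;;
     rK ::= 1 ;;
     For (odds 1 (2 ^ t)) (fun k =>
       fast_factor 1 (Lit LPi * rK / rP) ;;
       U (k * 2 ^ (m - t)) ::= rF ;;
       rK ::= rK + 2)) ;;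
   Out 1 ::= 1)%cmd.

(* Stores h_{s,v}(x) in rh, for x the value of rx. *)
Definition fast_h (m : nat) (w : nat -> nat) (s v : nat) (rx rh : loc) : cmd :=
  (rh ::= 0 ;;
   rQ ::= 1 ;;
   For (index_iota v (m - w s).+1) (fun t =>
     rS ::= 0 ;;
     rK ::= 1 ;;
     For (iota 0 (2 ^ w s)) (fun l =>
       For (odds (l * 2 ^ t).+1 (l.+1 * 2 ^ t)) (fun k =>
         fast_factor s (Lit LPi * (rK * rx) / rP) ;;
         rS ::= rS + U (k * 2 ^ (m - w s - t)) * rF ;;
         rK ::= rK + 2)) ;;
     rh ::= rh + rQ * rS ;;
     rQ ::= rQ / 2))%cmd.

Definition fast_update (m : nat) (w : nat -> nat) (s v : nat) : cmd :=
  (rK ::= 1 ;;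
   For (iota 0 (2 ^ w s)) (fun l =>
     For (odds (l * 2 ^ v).+1 (l.+1 * 2 ^ v)) (fun k =>
       fast_factor s (Lit LPi * (rK * rZ) / rP) ;;
       U (k * 2 ^ (m - w s - v)) ::= U (k * 2 ^ (m - w s - v)) * rF ;;
       rK ::= rK + 2)))%cmd.

(* [tie s v] tells which digit is selected when both are minimizers. *)
Definition fast_component (m : nat) (w : nat -> nat) (tie : nat -> nat -> bool)
    (s : nat) : cmd :=
  (rZ ::= 1 ;;
   rP ::= 2 ;;
   For (index_iota 2 (m - w s).+1) (fun v =>
     rP ::= rP * 2 ;;
     fast_h m w s v rZ rH0 ;;
     rX ::= rZ + rP / 2 ;;
     fast_h m w s v rX rH1 ;;
     Cond (tie s v) rH0 rH1 Skip (rZ ::= rX) ;;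
     fast_update m w s v) ;;
   Out s ::= rZ)%cmd.

Definition fast_cbc_dbd (m n : nat) (w : nat -> nat) (tie : nat -> nat -> bool)
    : cmd :=
  (fast_init m ;;
   For (index_iota 2 n.+1) (fast_component m w tie))%cmd.

(* The generating vector (Y_1 z_1, ..., Y_d z_d) read off the final memory; the
   constants z_j = 1 for j > d* and the scaling by Y_j are not counted. *)
Definition generating_vector {R : realType} (n : nat) (w : nat -> nat)
    (mu : loc -> R) (j : nat) : R :=
  2 ^+ w j * (if (j <= n)%N then mu (Out j) else 1).

(* Main.v *)
Require Import Defs.
From mathcomp Require Import all_boot all_order all_algebra.
From mathcomp Require Import archimedean boolp reals exp trigo.
Set Implicit Arguments.
Unset Strict Implicit.
Unset Printing Implicit Defensive.

Import Order.TTheory GRing.Theory Num.Theory.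
Local Open Scope ring_scope.

(** The idea is to let the program itself be the witness.  The trace demanded
    by the specification consists of the memories met during the execution:
    the vector after pass v of component s is the content of the cells U, and
    z_{s,v} is the natural number held by the register rZ.  Correctness is then
    a chain of loop invariants, one for each level of the program:
    [exec_fast_init], [exec_fast_h], [exec_fast_update], [exec_fast_pass] and
    finally [fast_cbc_dbd_correct].

    Two arithmetic facts make the invariants work.  For t >= 1 the consecutive
    ranges of odd k between l 2^t and (l+1) 2^t, for l < 2^w, concatenate to all
    the odd numbers below 2^(w+t) ([odds_flatten]); hence a register that starts
    at 1 and grows by 2 always holds k, and each double loop runs 2^(w+t-1)
    times.  Since k is odd, the address k 2^a determines both k and a
    ([odd_mul_expn2_inj]), so that no value of the initialization is
    overwritten by a later one.

    For the cost, worst cases do not depend on the memory: [worst_ops] adds up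
    along the loops.  One evaluation of h runs through at most 2^w 2^(t-1)
    entries for each t <= m - w, which sums geometrically to at most 2^m
    ([sum_expn2_pred]); the O(m - w) further operations on the outer level are
    absorbed in the same sum, as each t has at least one entry.  A pass thus
    costs O(2^m) operations, component s has fewer than m - w_s passes, and the
    initialization costs O(2^m), which the term n 2^m accounts for because
    n >= 1.  For the memory, every address is below 2^m and nine registers
    suffice, with expressions of bounded depth. *)

(** * Execution of loops *)

Section Commands.
Context {R : realType}.
Variable gamma : nat -> R.
Implicit Types (mu : loc -> R) (c : cmd) (body : nat -> cmd) (r : seq nat).

Lemma exec_For_cat r1 r2 body mu :
  exec gamma (For (r1 ++ r2) body) mu
  = exec gamma (For r2 body) (exec gamma (For r1 body) mu).
Proof. by elim: r1 mu => //= k r1 IH mu; rewrite IH. Qed.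

Lemma exec_For_nested (r : seq nat) (g : nat -> seq nat) body mu :
  exec gamma (For r (fun l => For (g l) body)) mu
  = exec gamma (For (flatten [seq g l | l <- r]) body) mu.
Proof. by elim: r mu => //= l r IH mu; rewrite IH exec_For_cat. Qed.

Lemma index_iota_recr a b :
  (a <= b)%N -> index_iota a b.+1 = rcons (index_iota a b) b.
Proof.
by move=> ab; rewrite /index_iota subSn // -addn1 iotaD cats1 subnKC.
Qed.

Lemma exec_For_recr a b body mu : (a <= b)%N ->
  exec gamma (For (index_iota a b.+1) body) mu
  = exec gamma (body b) (exec gamma (For (index_iota a b) body) mu).
Proof. by move=> /index_iota_recr ->; rewrite -cats1 exec_For_cat. Qed.

Lemma For_invariant (I : nat -> (loc -> R) -> Prop) a b body mu :
    (a <= b)%N -> I a mu ->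
    (forall k mu', (a <= k < b)%N -> I k mu' ->
       I k.+1 (exec gamma (body k) mu')) ->
  I b (exec gamma (For (index_iota a b) body) mu).
Proof.
move=> ab; rewrite -(subnKC ab); elim: (b - a)%N => [|n IH] Ia step.
  by rewrite addn0 /index_iota subnn in Ia *.
rewrite addnS exec_For_recr ?leq_addr //; apply: (step).
  by rewrite leq_addr /= addnS.
apply: IH => // k mu' /andP[ak kn]; apply: step.
by rewrite ak addnS ltnS ltnW.
Qed.

(** Syntactic frame condition: it also inspects the branch of a conditional that
    is not executed, so that it can be decided without knowing the memory. *)
Fixpoint untouched (a : loc) c : bool :=
  match c with
  | Skip => true
  | Assign b _ => a != b
  | Seq c1 c2 => untouched a c1 && untouched a c2
  | Cond _ _ _ c1 c2 => untouched a c1 && untouched a c2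
  end.

Lemma exec_untouched a c mu : untouched a c -> exec gamma c mu a = mu a.
Proof.
elim: c mu => //= [b e|c1 IH1 c2 IH2|le e1 e2 c1 IH1 c2 IH2] mu.
- by move=> /negPf ->.
- by case/andP=> h1 h2; rewrite IH2 // IH1.
- by case/andP=> h1 h2; case: ifP => _; [apply: IH1 | apply: IH2].
Qed.

Lemma untouched_For a r body :
  untouched a (For r body) = all (fun k => untouched a (body k)) r.
Proof. by elim: r => //= k r ->. Qed.

(** The maximum over both branches of each conditional, hence a bound that no
    longer refers to a memory. *)
Fixpoint worst_ops c : nat :=
  match c with
  | Skip => 0
  | Assign _ e => expr_ops e
  | Seq c1 c2 => worst_ops c1 + worst_ops c2
  | Cond _ e1 e2 c1 c2 =>
      (expr_ops e1 + expr_ops e2).+1 + maxn (worst_ops c1) (worst_ops c2)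
  end.

Lemma ops_worst c mu : (ops gamma c mu <= worst_ops c)%N.
Proof.
elim: c mu => //= [c1 IH1 c2 IH2|le e1 e2 c1 IH1 c2 IH2] mu.
  exact: leq_add.
rewrite leq_add2l; case: ifP => _; rewrite leq_max ?IH1 // IH2 orbT //.
Qed.

Lemma worst_ops_For r body :
  worst_ops (For r body) = (\sum_(k <- r) worst_ops (body k))%N.
Proof. by elim: r => [|k r IH] /=; rewrite ?big_nil // big_cons IH. Qed.

(** Like [worst_ops], independent of the memory: both branches of a conditional
    have to comply. *)
Fixpoint fits (P : pred loc) (T : nat) c : bool :=
  match c with
  | Skip => true
  | Assign a e => [&& P a, all P (expr_locs e) & (expr_temps e <= T)%N]
  | Seq c1 c2 => fits P T c1 && fits P T c2
  | Cond _ e1 e2 c1 c2 =>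
      [&& all P (expr_locs e1), all P (expr_locs e2),
          (maxn (expr_temps e1) (expr_temps e2).+1 <= T)%N,
          fits P T c1 & fits P T c2]
  end.

Lemma fits_For P T r body :
  fits P T (For r body) = all (fun k => fits P T (body k)) r.
Proof. by elim: r => //= k r ->. Qed.

Lemma fits_locs P T c mu :
  fits P T c -> all P (locs gamma c mu).
Proof.
elim: c mu => //= [a e|c1 IH1 c2 IH2|le e1 e2 c1 IH1 c2 IH2] mu.
- by case/and3P=> -> ->.
- by case/andP=> h1 h2; rewrite all_cat IH1 // IH2.
- case/and5P=> h1 h2 _ h3 h4; rewrite !all_cat h1 h2 /=.
  by case: ifP => _; [apply: IH1 | apply: IH2].
Qed.

Lemma fits_temps P T c mu :
  fits P T c -> (temps gamma c mu <= T)%N.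
Proof.
elim: c mu => //= [a e|c1 IH1 c2 IH2|le e1 e2 c1 IH1 c2 IH2] mu.
- by case/and3P.
- by case/andP=> h1 h2; rewrite geq_max IH1 // IH2.
- case/and5P=> _ _ h h3 h4; rewrite geq_max h /=.
  by case: ifP => _; [apply: IH1 | apply: IH2].
Qed.

(** The temporary cells are freed after each command, so they enter as a
    maximum T; only the locations accumulate. *)
Lemma memory_fits P T (s : seq loc) c mu :
  fits P T c -> {subset [predI P & working] <= s} ->
  (memory gamma c mu <= size s + T)%N.
Proof.
move=> fc sub; apply: leq_add; last exact: (fits_temps mu fc).
apply: uniq_leq_size (undup_uniq _) _ => a.
rewrite mem_undup mem_filter => /andP[wa]; move/(allP (fits_locs mu fc)) => Pa.
by apply: sub; rewrite inE /=; apply/andP.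
Qed.

End Commands.

(** * Ranges of odd numbers *)

Lemma iota0_recr n : iota 0 n.+1 = rcons (iota 0 n) n.
Proof. by rewrite -cats1 -(iotaD 0 n 1) addn1. Qed.

Lemma odds1_double n : odds 1 n.*2 = [seq i.*2.+1 | i <- iota 0 n].
Proof.
elim: n => // n IH; rewrite iota0_recr map_rcons -IH doubleS.
case: n {IH} => // n.
set b := n.+1.*2; have b1 : (0 < b)%N by [].
rewrite /odds index_iota_recr // index_iota_recr // !filter_rcons /=.
by rewrite /b odd_double.
Qed.

Lemma mem_odds a b k : (k \in odds a b) = [&& odd k, a <= k & k < b]%N.
Proof. by rewrite mem_filter mem_index_iota. Qed.

(** The endpoints l 2^t are even, so leaving them out loses no odd number; this
    is where t > 0 is needed.  The result is written as a double so as to match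
    [odds1_double], which turns it into an explicit enumeration. *)
Lemma odds_flatten n t : (0 < t)%N ->
  flatten [seq odds (l * 2 ^ t).+1 (l.+1 * 2 ^ t) | l <- iota 0 n]
  = odds 1 (n * 2 ^ t.-1).*2.
Proof.
case: t => // t _ /=.
elim: n => // n IH; rewrite iota0_recr map_rcons flatten_rcons IH.
have e k : (k * 2 ^ t.+1 = (k * 2 ^ t).*2)%N.
  by rewrite -mul2n expnS mulnCA.
rewrite !e; set a := (n * 2 ^ t)%N.
have ab : (a.*2 <= (n.+1 * 2 ^ t).*2)%N.
  by rewrite leq_double leq_mul2r leqnSn orbT.
set b := (n.+1 * 2 ^ t).*2 in ab *.
have od x y : (x.*2 < y)%N -> odds x.*2.+1 y = odds x.*2 y.
  by move=> xc; rewrite /odds /index_iota -(subnSK xc) /= odd_double.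
have ab' : (a.*2 < b)%N by rewrite ltn_double ltn_mul2r ltnSn expn_gt0.
rewrite (od a) // (od 0%N b) ?(leq_ltn_trans _ ab') //.
case: (posnP a) => [->|a0]; first by [].
rewrite (od 0%N) ?double_gt0 // /odds -filter_cat /index_iota !subn0.
by rewrite -{2}(subnKC ab) iotaD add0n.
Qed.

Lemma mem_odds_recr k i :
  (k \in odds 1 i.+1.*2) = (k == i.*2.+1) || (k \in odds 1 i.*2).
Proof. by rewrite !odds1_double iota0_recr map_rcons mem_rcons in_cons. Qed.

Lemma notin_odds i : ~ i.*2.+1 \in odds 1 i.*2.
Proof. by rewrite mem_odds => /and3P[_ _]; rewrite ltnNge leqW. Qed.

(** The exponent is the 2-adic valuation of the product. *)
Lemma odd_mul_expn2_inj k k' a b :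
  odd k -> odd k' -> (k * 2 ^ a = k' * 2 ^ b)%N -> k = k' /\ a = b.
Proof.
have val x c : odd x -> logn 2 (x * 2 ^ c)%N = c.
  move=> ox; rewrite lognM ?expn_gt0 ?(odd_gt0 ox) // pfactorK //.
  by rewrite logn_coprime ?coprime2n.
move=> ok ok' e; have ab : a = b by rewrite -(val k a ok) e val.
split=> //; apply/eqP; rewrite -(@eqn_pmul2r (2 ^ a)%N) ?expn_gt0 //.
by rewrite e ab.
Qed.

(** * Initialization, evaluation of h, and update *)

Section Correctness.
Context {R : realType}.
Variable gamma : nat -> R.
Implicit Types (mu : loc -> R) (body : nat -> cmd).

(** The invariant counts iterations: iteration i treats k = 2 i + 1, the value
    that the register rK must hold. *)
Lemma odd_loop_invariant (I : nat -> (loc -> R) -> Prop) n body mu :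
    I 0%N mu ->
    (forall i mu', (i < n)%N -> I i mu' ->
       I i.+1 (exec gamma (body i.*2.+1) mu')) ->
  I n (exec gamma (For (odds 1 n.*2) body) mu).
Proof.
move=> I0 step; rewrite odds1_double /For foldr_map -{2}(subn0 n).
exact: (For_invariant (body := fun i => body i.*2.+1) (leq0n n) I0).
Qed.

Definition agree_off (A : seq loc) mu mu' :=
  forall a, a \notin A -> mu' a = mu a.

Lemma sum_odds_nested n t (f : nat -> R) : (0 < t)%N ->
  \sum_(0 <= l < n) \sum_((l * 2 ^ t).+1 <= k < l.+1 * 2 ^ t | odd k) f k
  = \sum_(k <- odds 1 (n * 2 ^ t.-1).*2) f k.
Proof.
move=> t0; rewrite -odds_flatten // big_flatten big_map /index_iota subn0.
by apply: eq_bigr => l _; rewrite big_filter.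
Qed.

Lemma exec_fast_factor s arg mu a :
  exec gamma (fast_factor s arg) mu a
  = if a == rF then factor (gamma s) (eval gamma mu arg) else mu a.
Proof. by rewrite /= /factor expr2; case: (a == rF). Qed.

(** The register of x has an index above 4 so that it is not among those used by
    the loop. *)
Lemma fast_h_sum_loop s q (x y : R) c n mu :
    (4 < c)%N -> mu rK = 1 -> mu rS = 0 -> mu (Reg c) = x -> mu rP = y ->
  let mu' := exec gamma (For (odds 1 n.*2) (fun k =>
         fast_factor s (Lit LPi * (rK * Reg c) / rP) ;;
         rS ::= rS + U (k * q) * rF ;;
         rK ::= rK + 2)%cmd) mu in
  mu' rS = \sum_(k <- odds 1 n.*2)
       mu (U (k * q)) * factor (gamma s) (pi * (k%:R * x) / y)
  /\ agree_off [:: rK; rS; rF] mu mu'.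
Proof.
move=> c4 K1 S0 hx hy mu'.
suff: [/\ mu' rK = n.*2.+1%:R,
   mu' rS = \sum_(k <- odds 1 n.*2)
       mu (U (k * q)) * factor (gamma s) (pi * (k%:R * x) / y)
  & agree_off [:: rK; rS; rF] mu mu'] by case.
apply: (odd_loop_invariant (I := fun n mu' => [/\ mu' rK = n.*2.+1%:R,
   mu' rS = \sum_(k <- odds 1 n.*2)
       mu (U (k * q)) * factor (gamma s) (pi * (k%:R * x) / y)
  & agree_off [:: rK; rS; rF] mu mu'])).
  by split=> //; rewrite S0 /odds big_nil.
move=> i mu1 _ [eK eS off].
have ec : mu1 (Reg c) = x.
  by rewrite off // !inE; case: c c4 {hx mu'} => [|[|[|[|[]]]]].
have eP : mu1 rP = y by rewrite off.
have eU : mu1 (U (i.*2.+1 * q)) = mu (U (i.*2.+1 * q)) by rewrite off.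
split.
- rewrite [LHS]/= -[LHS]/(mu1 rK + 2).
  by rewrite eK doubleS -[i.*2.+3]addn2 natrD.
- rewrite -[LHS]/(mu1 rS + mu1 (U (i.*2.+1 * q))
     * exec gamma (fast_factor s (Lit LPi * (rK * Reg c) / rP)) mu1 rF).
  rewrite exec_fast_factor eqxx /= ec eP eU eK eS.
  by rewrite !odds1_double !big_map iota0_recr big_rcons.
- move=> a na; rewrite -(off a na) exec_untouched //=.
  by move: na; rewrite !inE !negb_or => /and3P[-> -> ->].
Qed.

(** The outer loop accumulates the sum over t while rQ is halved at each step;
    the vector u is only read. *)
Lemma exec_fast_h m w s v x c h mu :
    (0 < v <= m - w s)%N -> (4 < c)%N -> (4 < h)%N -> c != h ->
    mu (Reg c) = x%:R -> mu rP = 2 ^+ v ->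
  let mu' := exec gamma (fast_h m w s v (Reg c) (Reg h)) mu in
  mu' (Reg h) = dbd_h m w gamma (fun i => mu (U i)) s v x
  /\ agree_off [:: Reg h; rQ; rS; rK; rF] mu mu'.
Proof.
move=> /andP[v0 vm] c4 h4 ch hx hP mu'.
have regs : Reg c \notin [:: Reg h; rQ; rS; rK; rF]
    /\ Reg h \notin [:: rQ; rS; rK; rF].
  have big y : (4 < y)%N -> Reg y \notin [:: rQ; rS; rK; rF].
    by rewrite !inE; case: y => [|[|[|[|[]]]]].
  by rewrite in_cons negb_or !big // andbT; split.
case: regs => cn hn.
pose S t := \sum_(0 <= l < 2 ^ w s)
      \sum_((l * 2 ^ t).+1 <= k < l.+1 * 2 ^ t | odd k)
        mu (U (k * 2 ^ (m - w s - t)))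
        * factor (gamma s) (pi * (k%:R * x%:R) / 2 ^+ v).
suff: [/\ mu' (Reg h) = \sum_(v <= t < (m - w s).+1) 1 / 2 ^+ (t - v) * S t,
   mu' rQ = 1 / 2 ^+ ((m - w s).+1 - v)
  & agree_off [:: Reg h; rQ; rS; rK; rF] mu mu'] by case.
apply: (For_invariant (I := fun n mu' => [/\
   mu' (Reg h) = \sum_(v <= t < n) 1 / 2 ^+ (t - v) * S t,
   mu' rQ = 1 / 2 ^+ (n - v)
  & agree_off [:: Reg h; rQ; rS; rK; rF] mu mu'])).
- exact: leqW.
- rewrite big_geq // subnn divr1; split => //=.
  + by move: hn; rewrite !inE !negb_or => /andP[/negPf ->]; rewrite eqxx.
  + move=> a; rewrite !inE !negb_or /= => /and3P[/negPf -> /negPf -> _] //.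
move=> t mu1 /andP[vt tm] [eh eQ off].
rewrite ltnS in tm.
set body := (X in exec gamma X mu1).
pose mu2 := exec gamma (rS ::= 0 ;; rK ::= 1)%cmd mu1.
have off2 : agree_off [:: rS; rK] mu1 mu2.
  by move=> a; rewrite !inE !negb_or /mu2 /= => /andP[/negPf -> /negPf ->].
pose inner := For (iota 0 (2 ^ w s)) (fun l =>
       For (odds (l * 2 ^ t).+1 (l.+1 * 2 ^ t)) (fun k =>
         fast_factor s (Lit LPi * (rK * Reg c) / rP) ;;
         rS ::= rS + U (k * 2 ^ (m - w s - t)) * rF ;;
         rK ::= rK + 2))%cmd.
pose mu3 := exec gamma inner mu2.
have t0 : (0 < t)%N by apply: leq_trans vt.
have [eS off3] : mu3 rS = S t /\ agree_off [:: rK; rS; rF] mu2 mu3.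
  rewrite /mu3 /inner exec_For_nested odds_flatten //.
  have [|||||-> off3] := @fast_h_sum_loop s (2 ^ (m - w s - t)) x%:R (2 ^+ v) c
    (2 ^ w s * 2 ^ t.-1) mu2 => //.
  - rewrite off2 ?off //; move: cn; rewrite !inE !negb_or.
    by case/and5P=> _ _ -> -> _.
  - rewrite off2 ?off // !inE !orbF.
    by case: h h4 {mu' S ch eh hn cn off body inner mu3 hx hP} => [|[|]].
  split=> //; rewrite /S sum_odds_nested //; apply: eq_bigr => k _.
  by rewrite off2 ?off.
(* Only rh and rQ are assigned after the inner loops. *)
have e4 a : exec gamma body mu1 a =
   if a == rQ then
     (if rQ == Reg h then mu3 (Reg h) + mu3 rQ * mu3 rS else mu3 rQ) / 2
   else if a == Reg h then mu3 (Reg h) + mu3 rQ * mu3 rS else mu3 a by [].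
have h3 : mu3 (Reg h) = mu1 (Reg h).
  rewrite off3 ?off2 //; move: hn; rewrite !inE !negb_or;
    by case/and4P=> _ n1 n2 n3; rewrite ?n1 ?n2 ?n3.
have q3 : mu3 rQ = mu1 rQ by rewrite off3 ?off2.
have hQ : (Reg h == rQ) = false.
  by apply/negbTE; move: hn; rewrite !inE !negb_or => /andP[].
split.
- by rewrite e4 hQ eqxx h3 q3 eS eh eQ big_nat_recr.
- by rewrite e4 eqxx eq_sym hQ q3 eQ subSn // exprS invfM !div1r mulrC mul1r.
- move=> a na; rewrite -(off a na) e4.
  move: na; rewrite !inE !negb_or => /and5P[/negPf -> /negPf -> n1 n2 n3].
  by rewrite off3 ?off2 // !inE !negb_or ?n1 ?n2 ?n3.
Qed.

(** Every entry is multiplied exactly once, because distinct k have distinct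
    addresses; the invariant therefore says which entries have been multiplied
    and that the others still have their initial value. *)
Lemma exec_fast_update m w s v x mu :
    (0 < v <= m - w s)%N -> mu rZ = x%:R -> mu rP = 2 ^+ v ->
  let mu' := exec gamma (fast_update m w s v) mu in
  dbd_update m w gamma s v x (fun i => mu (U i)) (fun i => mu' (U i)).
Proof.
move=> /andP[v0 vm] hZ hP mu'.
set q := (2 ^ (m - w s - v))%N.
have q0 : (0 < q)%N by rewrite expn_gt0.
pose F k := factor (gamma s) (pi * (k%:R * x%:R) / 2 ^+ v).
pose N := (2 ^ w s * 2 ^ v.-1)%N.
pose I n mu' := [/\ mu' rK = n.*2.+1%:R, mu' rZ = x%:R /\ mu' rP = 2 ^+ v,
    (forall k : nat, k \in odds 1 n.*2 ->
       mu' (U (k * q)) = mu (U (k * q)) * F k)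
  & (forall j, (forall k : nat, k \in odds 1 n.*2 -> j <> k * q)%N ->
       mu' (U j) = mu (U j))].
have [_ _ hin hout] : I N mu'.
  have -> : mu' = exec gamma (For (odds 1 N.*2) (fun k =>
       fast_factor s (Lit LPi * (rK * rZ) / rP) ;;
       U (k * q) ::= U (k * q) * rF ;;
       rK ::= rK + 2)%cmd) (exec gamma (rK ::= 1)%cmd mu).
    by rewrite /mu' /fast_update -odds_flatten // -exec_For_nested.
  apply: odd_loop_invariant; first by split.
  move=> i mu1 _ [eK [eZ eP] ein eout].
  set k0 := i.*2.+1; set body := (X in exec gamma X _).
  have eU j : exec gamma body mu1 (U j) =
      if j == (k0 * q)%N then mu1 (U (k0 * q)) * F k0 else mu1 (U j).
    rewrite -[LHS]/(if j == (k0 * q)%N then mu1 (U (k0 * q)) *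
       exec gamma (fast_factor s (Lit LPi * (rK * rZ) / rP)) mu1 rF
       else mu1 (U j)).
    by rewrite exec_fast_factor eqxx /= eK eZ eP.
  split.
  - by rewrite -[LHS]/(mu1 rK + 2) eK doubleS -[i.*2.+3]addn2 natrD.
  - by [].
  - move=> k; rewrite mem_odds_recr eU eqn_pmul2r //.
    have [->|_ /= kin] := eqVneq k k0; last exact: ein.
    rewrite eout // => k1 k1in /eqP; rewrite eqn_pmul2r // => /eqP e.
    by move: k1in; rewrite -e => /notin_odds.
  - move=> j jout; rewrite eU ifN; last first.
      by apply/eqP/jout; rewrite mem_odds_recr eqxx.
    by apply: eout => k kin; apply: jout; rewrite mem_odds_recr kin orbT.
split=> [l k lw /andP[lk kl] ok|i iout].
  apply: hin; rewrite -odds_flatten //; apply/flatten_mapP; exists l.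
    by rewrite mem_iota.
  by rewrite mem_odds ok lk.
apply: hout => k; rewrite -odds_flatten // => /flatten_mapP[l].
rewrite mem_iota mem_odds => lw /and3P[ok lk kl].
by apply: (iout l) => //; rewrite lk.
Qed.

(** Iteration t writes at the addresses k 2^(m - t) with k odd, which have
    2-adic valuation m - t: it cannot destroy what an earlier t has stored. *)
Lemma exec_fast_init m mu : (0 < m)%N ->
  let mu' := exec gamma (fast_init m) mu in
  dbd_init m gamma (fun i => mu' (U i)) /\ mu' (Out 1) = 1.
Proof.
move=> m0 mu'; split=> //.
pose G t k : R := factor (gamma 1%N) (pi * k%:R / 2 ^+ t).
pose done n mu1 := forall t k, (2 <= t < n)%N -> k \in odds 1 (2 ^ t) ->
  mu1 (U (k * 2 ^ (m - t))) = G t k.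
pose I n (mu1 : loc -> R) := mu1 rP = 2 ^+ n.-1 /\ done n mu1.
suff [_ fin] : I m.+1 mu'.
  move=> t k tm /andP[k0 kt] ok; apply: fin => //.
  by rewrite mem_odds ok k0; move: kt; rewrite -ltnS subn1 prednK ?expn_gt0.
pose inner t k := (fast_factor 1 (Lit LPi * rK / rP) ;;
       U (k * 2 ^ (m - t)) ::= rF ;;
       rK ::= rK + 2)%cmd.
suff : I m.+1 (exec gamma (For (index_iota 2 m.+1) (fun t =>
   rP ::= rP * 2 ;; rK ::= 1 ;; For (odds 1 (2 ^ t)) (inner t))%cmd)
   (exec gamma (rP ::= 2)%cmd mu)) by [].
apply: For_invariant => //.
  by split=> // t k /andP[t2]; rewrite ltnNge t2.
move=> t mu1 /andP[t2 tm] [eP1 done1].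
set mu2 := exec gamma (rP ::= rP * 2 ;; rK ::= 1)%cmd mu1.
have e2t : (2 ^ t = (2 ^ t.-1).*2)%N.
  by case: t t2 {tm eP1 done1 mu2} => // t; rewrite expnS mul2n.
suff [_ eP3 done3 new3] :
    let mu3 := exec gamma (For (odds 1 (2 ^ t)) (inner t)) mu2 in
    [/\ mu3 rK = (2 ^ t.-1).*2.+1%:R, mu3 rP = 2 ^+ t, done t mu3 &
      forall k : nat, k \in odds 1 (2 ^ t.-1).*2 ->
        mu3 (U (k * 2 ^ (m - t))) = G t k].
  split=> // t1 k /andP[t12]; rewrite ltnS leq_eqVlt => /predU1P[->|t1t] kin.
    by apply: new3; rewrite -e2t.
  by apply: done3; rewrite ?t12.
rewrite e2t.
apply: (odd_loop_invariant (I := fun i mu3 =>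
  [/\ mu3 rK = i.*2.+1%:R, mu3 rP = 2 ^+ t, done t mu3 &
      forall k : nat, k \in odds 1 i.*2 -> mu3 (U (k * 2 ^ (m - t))) = G t k])).
  split=> //; rewrite -[LHS]/(mu1 rP * 2) eP1.
  by case: t t2 {tm eP1 done1 mu2 e2t} => // t _; rewrite exprSr.
move=> i mu3 _ [eK eP done3 new3].
set k0 := i.*2.+1.
have eU j : exec gamma (inner t k0) mu3 (U j) =
    if j == (k0 * 2 ^ (m - t))%N then G t k0 else mu3 (U j).
  rewrite -[LHS]/(if j == (k0 * 2 ^ (m - t))%N then
     exec gamma (fast_factor 1 (Lit LPi * rK / rP)) mu3 rF else mu3 (U j)).
  by rewrite exec_fast_factor eqxx /= eK eP.
have ok0 : odd k0 by rewrite /= odd_double.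
split=> //.
- by rewrite -[LHS]/(mu3 rK + 2) eK doubleS -[i.*2.+3]addn2 natrD.
- move=> t1 k tt1 kin; rewrite eU ifN; first exact: done3.
  have ok : odd k by move: kin; rewrite mem_odds => /andP[].
  apply/eqP => /(odd_mul_expn2_inj ok ok0)[_ e].
  by case/andP: tt1 => _; rewrite -(ltn_sub2lE (m := m)) // e ltnn.
- move=> k; rewrite mem_odds_recr eU eqn_pmul2r ?expn_gt0 //.
  by have [->|_ /=] := eqVneq k k0; last exact: new3.
Qed.
End Correctness.

(** * The execution as a trace *)

(** The body of the loop on v in [fast_component]. *)
Definition fast_pass m w (tie : nat -> nat -> bool) s v : cmd :=
  (rP ::= rP * 2 ;;
   fast_h m w s v rZ rH0 ;;
   rX ::= rZ + rP / 2 ;;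
   fast_h m w s v rX rH1 ;;
   Cond (tie s v) rH0 rH1 Skip (rZ ::= rX) ;;
   fast_update m w s v)%cmd.

Section Trace.
Context {R : realType}.
Variables (gamma : nat -> R) (m : nat) (w : nat -> nat).
Variable tie : nat -> nat -> bool.
Implicit Types (mu : loc -> R).

Lemma untouched_fast_update a s v :
    all (fun b => a != b) [:: rK; rF] -> (forall i, a != U i) ->
  untouched a (fast_update m w s v).
Proof.
rewrite /= => /and3P[aK aF _] aU; rewrite aK untouched_For.
apply/allP => l _; rewrite untouched_For; apply/allP => k _ /=.
by rewrite aK aF aU.
Qed.

Lemma untouched_fast_h a s v x h :
    all (fun b => a != b) [:: h; rQ; rS; rK; rF] ->
  untouched a (fast_h m w s v x h).
Proof.
rewrite /= => /and5P[ah aQ aS aK /andP[aF _]]; rewrite ah aQ untouched_For.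
apply/allP => t _ /=; rewrite ah aQ aS aK untouched_For /= andbT.
apply/allP => l _; rewrite untouched_For; apply/allP => k _ /=.
by rewrite aK aF aS.
Qed.

(** The digit is the negation of the outcome of the comparison.  In case of a
    tie, [tie s v] decides between the large and the strict comparison, and
    either outcome designates a minimizer. *)
Lemma exec_fast_pass s v z mu :
    (2 <= v <= m - w s)%N -> mu rZ = z%:R -> mu rP = 2 ^+ v.-1 ->
  let mu' := exec gamma (fast_pass m w tie s v) mu in
  exists b : bool,
    let x := (z + b * 2 ^ v.-1)%N in
    [/\ forall b' : bool,
          dbd_h m w gamma (fun i => mu (U i)) s v x
          <= dbd_h m w gamma (fun i => mu (U i)) s v (z + b' * 2 ^ v.-1),
        mu' rZ = x%:R, mu' rP = 2 ^+ v
      & dbd_update m w gamma s v x (fun i => mu (U i)) (fun i => mu' (U i))].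
Proof.
move=> /andP[v2 vm] hZ hP mu'.
have v1 : (0 < v <= m - w s)%N by rewrite (ltnW v2).
set u := fun i => mu (U i).
pose mu1 := exec gamma (rP ::= rP * 2)%cmd mu.
pose mu2 := exec gamma (fast_h m w s v rZ rH0) mu1.
pose mu3 := exec gamma (rX ::= rZ + rP / 2)%cmd mu2.
pose mu4 := exec gamma (fast_h m w s v rX rH1) mu3.
pose mu5 := exec gamma (Cond (tie s v) rH0 rH1 Skip (rZ ::= rX)%cmd) mu4.
have P1 : mu1 rP = 2 ^+ v.
  rewrite -[LHS]/(mu rP * 2) hP -exprSr prednK // ltnW //.
(* The registers rZ, rX, rH0 and rH1 have the indices 5, 6, 7 and 8. *)
have [h2 off2] := exec_fast_h (mu := mu1) (c := 5) (h := 7) gamma v1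
  isT isT isT hZ P1.
rewrite -/mu2 -/u in h2 off2.
have X3 : mu3 rX = (z + 2 ^ v.-1)%:R.
  rewrite -[LHS]/(mu2 rZ + mu2 rP / 2) !off2 // P1 -[mu1 rZ]/(mu rZ) hZ.
  rewrite natrD natrX -(prednK (ltnW v2)) /= exprSr mulfK //.
  by rewrite pnatr_eq0.
have P3 : mu3 rP = 2 ^+ v by rewrite -P1 -[LHS]/(mu2 rP) off2.
have u3 : (fun i => mu3 (U i)) = u.
  by apply/funext => i; rewrite -[LHS]/(mu2 (U i)) off2.
have [h4 off4] := exec_fast_h (mu := mu3) (c := 6) (h := 8) gamma v1
  isT isT isT X3 P3.
rewrite -/mu4 u3 in h4 off4.
have H4 : mu4 rH0 = dbd_h m w gamma u s v z by rewrite off4.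
have u5 : (fun i => mu5 (U i)) = u.
  rewrite -u3; apply/funext => i; rewrite /mu5 exec_untouched //.
  by rewrite off4.
have P5 : mu5 rP = 2 ^+ v by rewrite /mu5 exec_untouched // off4.
have e' : mu' = exec gamma (fast_update m w s v) mu5 by [].
have Z4 : mu4 rZ = z%:R by rewrite off4 // -[LHS]/(mu2 rZ) off2.
have X4 : mu4 rX = (z + 2 ^ v.-1)%:R by rewrite off4.
have P' : mu' rP = 2 ^+ v by rewrite e' exec_untouched // untouched_fast_update.
have Z' : mu' rZ = mu5 rZ by rewrite e' exec_untouched // untouched_fast_update.
pose b := ~~ test gamma mu4 (tie s v) rH0 rH1.
have Z5 : mu5 rZ = (z + b * 2 ^ v.-1)%:R.
  rewrite /mu5 /= /b; case: test; rewrite /= ?addn0 ?mul1n //.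
exists b; split; rewrite ?Z' //; last first.
  by rewrite e' -u5; apply: exec_fast_update.
move: Z5 => _; rewrite /b /test [eval _ _ rH0]H4 [eval _ _ rH1]h4 => b'.
case: (boolP (_ < _ ?<= if _)) => [/lteifW|] le;
  case: b'; rewrite ?addn0 ?mul1n //=.
by move: le; rewrite -lteifNE => /lteifW.
Qed.

(** The memory after pass v of component s, when the component is started from
    the memory mu; for v = 1 no pass has been made. *)
Definition fast_state s v mu :=
  exec gamma (For (index_iota 2 v.+1) (fast_pass m w tie s))
    (exec gamma (rZ ::= 1 ;; rP ::= 2)%cmd mu).

Lemma exec_fast_component s mu :
  exec gamma (fast_component m w tie s) mu
  = exec gamma (Out s ::= rZ)%cmd (fast_state s (m - w s) mu).
Proof. by []. Qed.

Lemma fast_stateS s v mu : (2 <= v)%N ->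
  fast_state s v mu = exec gamma (fast_pass m w tie s v) (fast_state s v.-1 mu).
Proof. by case: v => // v v2; rewrite /fast_state exec_For_recr. Qed.

(** That rZ holds a natural number is what allows z_{s,v} to be read off the
    memory, by truncation, in [fast_cbc_dbd_correct]. *)
Lemma fast_state_reg s v mu : (0 < v <= m - w s)%N ->
  (exists z, fast_state s v mu rZ = z%:R) /\ fast_state s v mu rP = 2 ^+ v.
Proof.
case: v => // v; elim: v => [|v IH] /= vm.
  by split; first by exists 1%N.
have [[z Z] P] := IH (ltnW vm); rewrite fast_stateS //.
have [b [_ -> -> _]] := exec_fast_pass (v := v.+2) vm Z P.
by split; first eexists.
Qed.

Lemma untouched_fast_component j s :
  j != s -> untouched (Out j) (fast_component m w tie s).
Proof.
move=> js.
rewrite -[untouched _ _]/(untouched (Out j) (For (index_iota 2 (m - w s).+1)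
  (fast_pass m w tie s)) && (j != s)).
rewrite js andbT untouched_For; apply/allP => v _.
rewrite -[untouched _ _]/[&& untouched (Out j) (fast_h m w s v rZ rH0),
  untouched (Out j) (fast_h m w s v rX rH1)
  & untouched (Out j) (fast_update m w s v)].
by rewrite !untouched_fast_h ?untouched_fast_update.
Qed.

(** The memory when component s is about to be started, s >= 2. *)
Definition fast_start s mu :=
  exec gamma
    (fast_init m ;; For (index_iota 2 s) (fast_component m w tie))%cmd mu.

Lemma fast_startS s mu : (2 <= s)%N ->
  fast_start s.+1 mu = exec gamma (fast_component m w tie s) (fast_start s mu).
Proof. by move=> s2; rewrite /fast_start /= exec_For_recr. Qed.

(** Each output cell is written once, by the component of the same index (by the
    initialization for j = 1), so that its value survives to the end. *)
Lemma fast_start_out n j mu : (0 < m)%N -> (1 <= j <= n)%N ->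
  fast_start n.+1 mu (Out j)
  = if j == 1%N then 1 else fast_state j (m - w j) (fast_start j mu) rZ.
Proof.
move=> m0 /andP[j1 jn].
have {n jn}-> : fast_start n.+1 mu (Out j) = fast_start j.+1 mu (Out j).
  elim: n jn => [|n IH]; first by case: j j1.
  rewrite leq_eqVlt => /predU1P[->//|]; rewrite ltnS => jn.
  have n2 : (2 <= n.+1)%N by rewrite ltnS (leq_trans j1).
  rewrite fast_startS // exec_untouched ?IH // untouched_fast_component //.
  by rewrite neq_ltn ltnS jn.
case: eqP => [->|/eqP j_neq1]; first by case: (exec_fast_init gamma mu m0).
have j2 : (2 <= j)%N by rewrite ltn_neqAle eq_sym j_neq1.
by rewrite fast_startS // exec_fast_component /= eqxx.
Qed.

(** The trace is the sequence of the actual memories.  Component 1 has no pass: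
    its only memory is the one left by the initialization. *)
Lemma fast_cbc_dbd_correct d n mu :
    (0 < m)%N -> (0 < n)%N -> (forall s, (1 <= s <= n)%N -> (w s < m)%N) ->
    w 1%N = 0%N ->
  exists z : nat -> nat, dbd_result m w gamma d n z /\
    forall j, (1 <= j <= d)%N ->
      generating_vector n w (exec gamma (fast_cbc_dbd m n w tie) mu) j
      = (2 ^ w j * z j)%:R.
Proof.
move=> m0 n0 wm w1.
pose st s v := if (s <= 1)%N then fast_start 2 mu
               else fast_state s v (fast_start s mu).
pose zz s v := Num.truncn (st s v rZ).
pose u s v i := st s v (U i).
pose z j := if (2 <= j <= n)%N then zz j (m - w j)%N else 1%N.
have dig s : (2 <= s <= n)%N -> (0 < m - w s)%N.
  by case/andP=> s2 sn; rewrite subn_gt0 wm // sn ltnW.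
have stE s v : (2 <= s)%N -> st s v = fast_state s v (fast_start s mu).
  by move=> s2; rewrite /st [(s <= 1)%N]leqNgt s2.
have zzE s v : (2 <= s)%N -> (0 < v <= m - w s)%N -> st s v rZ = (zz s v)%:R.
  move=> s2 /(fast_state_reg (fast_start s mu))[[x Z] _].
  by rewrite /zz stE // Z natrK.
exists z; split; last first.
  move=> j /andP[j1 jd]; rewrite /generating_vector natrM natrX; congr (_ * _).
  case: (leqP j n) => jn; last by rewrite /z [(j <= n)%N]leqNgt jn andbF.
  rewrite -[exec gamma _ mu]/(fast_start n.+1 mu) fast_start_out ?j1 //.
  rewrite /z jn andbT.
  case: eqP => [->//|/eqP j_neq1].
  have j2 : (2 <= j)%N by rewrite ltn_neqAle eq_sym j_neq1.
  by rewrite j2 -stE // zzE // dig ?j2 //=.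
exists zz, u; split.
- split; last by [].
  by case: (exec_fast_init gamma mu m0).
- move=> s /andP[s2 sn]; split.
  + by rewrite /zz stE // -[X in Num.truncn X]/1 truncn1.
  + rewrite /u stE //; case: s s2 sn => // s; rewrite ltnS => s1 sn /=.
    move: s1; rewrite leq_eqVlt => /predU1P[<-|s2] //.
    by rewrite stE // fast_startS // exec_fast_component.
  + by rewrite /z s2 sn.
- move=> s v /andP[s2 sn] /andP[v2 vm].
  have Z : st s v.-1 rZ = (zz s v.-1)%:R.
    by apply: zzE => //; case: v v2 vm => [|[|v]] // _ /ltnW.
  have P : st s v.-1 rP = 2 ^+ v.-1.
    rewrite stE //; case: (@fast_state_reg s v.-1 (fast_start s mu)) => //.
    by case: v v2 vm {Z} => [|[|v]] // _ /ltnW.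
  have v2m : (2 <= v <= m - w s)%N by rewrite v2.
  have [b [hmin hZ _ upd]] := exec_fast_pass v2m Z P.
  move: hZ upd; rewrite stE // -fast_stateS // -!stE // => hZ upd.
  have zzv : zz s v = (zz s v.-1 + b * 2 ^ v.-1)%N by rewrite {1}/zz hZ natrK.
  split; last by rewrite zzv.
  by exists b.
- by move=> j /andP[nj _]; rewrite /z [(j <= n)%N]leqNgt nj andbF.
Qed.

End Trace.

(** * Number of operations and memory *)

Section Costs.
Local Open Scope nat_scope.
Implicit Types (m s v t n c : nat) (w : nat -> nat).

Lemma sum_odds_const n c : \sum_(k <- odds 1 n.*2) c = n * c.
Proof.
rewrite odds1_double big_map big_const_seq count_predT size_iota.
by rewrite iter_addn_0 mulnC.
Qed.

Lemma sum_odds_nested_const n t c : 0 < t ->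
  \sum_(l <- iota 0 n) \sum_(k <- odds (l * 2 ^ t).+1 (l.+1 * 2 ^ t)) c
  = n * 2 ^ t.-1 * c.
Proof.
by move=> t0; rewrite -sum_odds_const -odds_flatten // big_flatten big_map.
Qed.

(** The geometric sum that makes the cost of all levels t comparable with the
    cost of the last one. *)
Lemma sum_expn2_pred a b : 0 < a -> \sum_(a <= t < b.+1) 2 ^ t.-1 <= 2 ^ b.
Proof.
move=> a0; elim: b => [|b IH]; first by rewrite big_geq.
have [ab|ba] := leqP a b.+1; last by rewrite big_geq.
by rewrite big_nat_recr //= expnS mul2n -addnn leq_add2r.
Qed.

Lemma worst_ops_fast_init m : worst_ops (fast_init m) <= 10 * 2 ^ m.
Proof.
rewrite /= addn0 worst_ops_For.
apply: (@leq_trans (\sum_(2 <= t < m.+1) 10 * 2 ^ t.-1)).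
  rewrite big_nat [leqRHS]big_nat; apply: leq_sum => -[//|t] _.
  rewrite /= worst_ops_For expnS mul2n /= sum_odds_const.
  rewrite (mulSn 9) mulnC leq_add2r.
  by rewrite expn_gt0.
by rewrite -big_distrr leq_mul2l sum_expn2_pred.
Qed.

Lemma worst_ops_fast_h m w s v x h : w s <= m -> 0 < v ->
  worst_ops (fast_h m w s v (Reg x) (Reg h)) <= 15 * 2 ^ m.
Proof.
move=> wm v0; rewrite /= worst_ops_For.
apply: (@leq_trans (\sum_(v <= t < (m - w s).+1) 15 * 2 ^ w s * 2 ^ t.-1)).
  rewrite big_nat [leqRHS]big_nat; apply: leq_sum => t /andP[vt _].
  rewrite /= worst_ops_For.
  under eq_bigr => l _ do rewrite worst_ops_For /=.
  rewrite sum_odds_nested_const ?(leq_trans v0) // !add0n.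
  rewrite -[leqRHS]mulnA (mulnDl 12 3).
  by rewrite mulnC leq_add2l leq_pmulr // muln_gt0 !expn_gt0.
rewrite -big_distrr /= -mulnA leq_mul2l /= -[in X in _ <= X](subnKC wm) expnD.
by rewrite leq_mul2l sum_expn2_pred ?orbT.
Qed.

Lemma worst_ops_fast_update m w s v : 0 < v <= m - w s -> w s <= m ->
  worst_ops (fast_update m w s v) <= 11 * 2 ^ m.
Proof.
move=> /andP[v0 vm] wm; rewrite /= worst_ops_For.
under eq_bigr => l _ do rewrite worst_ops_For /=.
rewrite sum_odds_nested_const //= mulnC leq_mul2l /= -expnD leq_exp2l //.
by rewrite -(subnKC wm) leq_add2l (leq_trans (leq_pred _)).
Qed.

Lemma worst_ops_fast_component m w tie s : w s <= m ->
  worst_ops (fast_component m w tie s) <= 45 * ((m - w s) * 2 ^ m).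
Proof.
move=> wm; rewrite /= addn0 worst_ops_For.
apply: (@leq_trans (\sum_(2 <= v < (m - w s).+1) 45 * 2 ^ m)).
  rewrite big_nat [leqRHS]big_nat; apply: leq_sum => v.
  rewrite ltnS => /andP[v2 vm].
  rewrite -[worst_ops _]/(1 + (worst_ops (fast_h m w s v rZ rH0) + (2 +
    (worst_ops (fast_h m w s v rX rH1) +
      (1 + worst_ops (fast_update m w s v)))))).
  rewrite [leqRHS](_ : _ = 1 * 2 ^ m + (15 * 2 ^ m + (2 * 2 ^ m + (15 * 2 ^ m +
    (1 * 2 ^ m + 11 * 2 ^ m))))); last by rewrite -!mulnDl.
  have N0 : 0 < 2 ^ m by rewrite expn_gt0.
  have v0 := ltnW v2.
  apply: leq_add; first by rewrite leq_pmulr.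
  apply: leq_add; first exact: worst_ops_fast_h.
  apply: leq_add; first by rewrite leq_pmulr.
  apply: leq_add; first exact: worst_ops_fast_h.
  apply: leq_add; first by rewrite leq_pmulr.
  by apply: worst_ops_fast_update; rewrite ?v0.
by rewrite sum_nat_const_nat mulnCA leq_mul2l leq_mul2r subSS leq_subr !orbT.
Qed.

Lemma worst_ops_fast_cbc_dbd m w tie n : 0 < n ->
    (forall s, 1 <= s <= n -> w s <= m) ->
  worst_ops (fast_cbc_dbd m n w tie)
  <= 45 * (n * 2 ^ m + \sum_(1 <= s < n.+1) (m - w s) * 2 ^ m).
Proof.
move=> n0 wm; rewrite [worst_ops _]/= mulnDr.
rewrite -[X in X <= _]/(worst_ops (fast_init m) + _).
apply: leq_add.
  apply: leq_trans (worst_ops_fast_init m) _.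
  by rewrite leq_mul // leq_pmull.
rewrite worst_ops_For big_distrr /= [leqRHS]big_ltn //.
apply: leq_trans (leq_addl _ _).
rewrite big_nat [leqRHS]big_nat; apply: leq_sum => s.
rewrite ltnS => /andP[s2 sn].
by apply: worst_ops_fast_component; rewrite wm // sn ltnW.
Qed.

(** There are 2^m addresses in the vector and nine registers; the output is not
    counted as memory. *)
Definition footprint m (a : loc) : bool :=
  match a with U i => i < 2 ^ m | Reg i => i < 9 | Out _ => true end.

Lemma footprint_address m k a b :
  k < 2 ^ b -> a + b <= m -> footprint m (U (k * 2 ^ a)).
Proof.
move=> kb abm; apply: (@leq_trans (2 ^ (a + b))); last by rewrite leq_exp2l.
by rewrite expnD mulnC ltn_mul2l expn_gt0.
Qed.

Lemma footprint_nested m w s t l k :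
    t <= m - w s -> w s <= m -> l \in iota 0 (2 ^ w s) ->
    k \in odds (l * 2 ^ t).+1 (l.+1 * 2 ^ t) ->
  footprint m (U (k * 2 ^ (m - w s - t))).
Proof.
move=> tm wm; rewrite mem_iota mem_odds add0n => /andP[_ lw] /and3P[_ _ kl].
apply: (@footprint_address _ _ _ (w s + t)).
  by rewrite expnD (leq_trans kl) // leq_mul2r lw orbT.
by rewrite addnC addnAC -addnA subnK // subnKC.
Qed.

(** The deepest expression is the factor 1 + gamma log(1 / rF^2), evaluated from
    left to right: it takes 5 temporary cells. *)
Lemma fits_fast_init m : fits (footprint m) 5 (fast_init m).
Proof.
rewrite /= fits_For andbT; apply/allP => t.
rewrite mem_index_iota ltnS => /andP[_ tm].
rewrite /= fits_For; apply/allP => k; rewrite mem_odds => /and3P[_ _ kt].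
have /= -> // := footprint_address (a := m - t) kt.
by rewrite subnK.
Qed.

Lemma fits_fast_h m w s v x h : w s <= m -> x < 9 -> h < 9 ->
  fits (footprint m) 5 (fast_h m w s v (Reg x) (Reg h)).
Proof.
move=> wm x9 h9; rewrite /= h9 fits_For; apply/allP => t.
rewrite mem_index_iota ltnS => /andP[_ tm] /=; rewrite h9 !andbT fits_For /=.
apply/allP => l lw; rewrite fits_For; apply/allP => k kl.
rewrite /= x9 /= !andbT.
exact: footprint_nested kl.
Qed.

Lemma fits_fast_update m w s v : w s <= m -> v <= m - w s ->
  fits (footprint m) 5 (fast_update m w s v).
Proof.
move=> wm vm; rewrite /= fits_For.
apply/allP => l lw; rewrite fits_For; apply/allP => k kl.
have := footprint_nested vm wm lw kl; rewrite /= => ->.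
by [].
Qed.

Lemma fits_fast_component m w tie s : w s <= m ->
  fits (footprint m) 5 (fast_component m w tie s).
Proof.
move=> wm; rewrite -[fits _ _ _]/(fits (footprint m) 5
  (For (index_iota 2 (m - w s).+1) (fast_pass m w tie s)) && true).
rewrite andbT fits_For; apply/allP => v.
rewrite mem_index_iota ltnS => /andP[_ vm].
rewrite -[fits _ _ _]/[&& fits (footprint m) 5 (fast_h m w s v rZ rH0),
  fits (footprint m) 5 (fast_h m w s v rX rH1)
  & fits (footprint m) 5 (fast_update m w s v)].
by rewrite !fits_fast_h // fits_fast_update.
Qed.

Lemma fits_fast_cbc_dbd m w tie n : (forall s, 1 <= s <= n -> w s <= m) ->
  fits (footprint m) 5 (fast_cbc_dbd m n w tie).
Proof.
move=> wm; rewrite -[fits _ _ _]/(fits (footprint m) 5 (fast_init m) &&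
  fits (footprint m) 5 (For (index_iota 2 n.+1) (fast_component m w tie))).
rewrite fits_fast_init fits_For; apply/allP => s.
rewrite mem_index_iota ltnS => /andP[s2 sn].
by rewrite fits_fast_component // wm // sn ltnW.
Qed.

Lemma working_footprint m :
  {subset [predI footprint m & working]
   <= [seq U i | i <- iota 0 (2 ^ m)] ++ [seq Reg i | i <- iota 0 9]}.
Proof.
case=> [i|i|i]; rewrite inE mem_cat => /andP[im // _]; apply/orP.
  by left; apply: map_f; rewrite mem_iota.
by right; apply: map_f; rewrite mem_iota.
Qed.

End Costs.

Lemma min_dstar_gt0 m w d D :
  (0 < d)%N -> is_dstar m w D -> (0 < min_dstar d D)%N.
Proof. by case: D => //= n d0 [n0 _ _]; rewrite leq_min d0. Qed.

Lemma min_dstar_w_lt m w d D s :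
    (forall j, (1 <= j)%N -> (w j <= w j.+1)%N) -> is_dstar m w D ->
  (1 <= s <= min_dstar d D)%N -> (w s < m)%N.
Proof.
move=> wmono; case: D => [n|] /=; last by move=> ltm /andP[s1 _]; apply: ltm.
case=> n0 wn _ /andP[s1]; rewrite leq_min => /andP[_ sn].
apply: leq_ltn_trans wn; elim: n sn {n0} => [|n IH]; first by rewrite leqNgt s1.
rewrite leq_eqVlt => /predU1P[->//|]; rewrite ltnS => sn.
by apply: leq_trans (IH sn) (wmono _ (leq_trans s1 sn)).
Qed.

Theorem theorem5 :
  exists C : nat,
  forall (R : realType) (m d : nat) (gamma : nat -> R) (w : nat -> nat)
         (D : option nat) (tie : nat -> nat -> bool) (mu0 : loc -> R),
    (1 <= m)%N -> (1 <= d)%N ->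
    (forall j, (1 <= j)%N -> 0 < gamma j) ->
    w 1%N = 0%N -> (forall j, (1 <= j)%N -> (w j <= w j.+1)%N) ->
    is_dstar m w D ->
    let n := min_dstar d D in
    let algo := fast_cbc_dbd m n w tie in
    [/\ exists z : nat -> nat,
          dbd_result m w gamma d n z /\
          forall j, (1 <= j <= d)%N ->
            generating_vector n w (exec gamma algo mu0) j
            = (2 ^ w j * z j)%:R,
        (ops gamma algo mu0
         <= C * (n * 2 ^ m + \sum_(1 <= s < n.+1) (m - w s) * 2 ^ m))%N
      & (memory gamma algo mu0 <= C * 2 ^ m)%N].
Proof.
(* A pass costs at most (1 + 15 + 2 + 15 + 1 + 11) 2^m = 45 * 2^m: doubling rP,
   two evaluations of h with the computation of rX in between, the comparison,
   the update.  This exceeds the 10 of the initialization and the 1 + 9 + 5 of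
   the memory. *)
exists 45%N => R m d gamma w D tie mu0 m0 d0 _ w1 wmono hD n algo.
have n0 : (0 < n)%N by apply: min_dstar_gt0 hD.
have wlt s : (1 <= s <= n)%N -> (w s < m)%N by apply: min_dstar_w_lt.
have wle s : (1 <= s <= n)%N -> (w s <= m)%N by move/wlt/ltnW.
split; first exact: fast_cbc_dbd_correct.
  exact: leq_trans (ops_worst _ _ _) (worst_ops_fast_cbc_dbd tie n0 wle).
apply: leq_trans (memory_fits gamma mu0 (fits_fast_cbc_dbd tie wle)
  (@working_footprint m)) _.
rewrite size_cat !size_map !size_iota -addnA (mulSn 44) leq_add2l.
by rewrite (@leq_trans 44) // leq_pmulr // expn_gt0.
Qed.
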